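(* Let $D\subset\mathbb{R}^n$ be a bounded domain and let the point sequence $\chi=\{\chi_i\}$ be constructed by starting from a one-point set $\chi=\{\chi_1\}\subset D$ and recursively replacing $\chi$ by $\chi\cup\{\chi_{new}\}$ with $$\chi_{new}=\arg\max_{x\in D}\Big(\min_{\chi_i\in\chi}\|x-\chi_i\|_2\Big).$$ Then there is $N\in\mathbb{N}$ such that whenever the size of $\chi$ is larger than $N$, $\chi$ is quasi-uniform over $D$ with uniformity constant $4$, i.e. $$\frac14q_\chi\le h_{D,\chi}\le4q_\chi.$$
   Context: For a finite set $\chi=\{\chi_i\}\subset D$: the fill distance is $h_{D,\chi}=\sup_{x\in D}\min_{\chi_i\in\chi}\|x-\chi_i\|_2$ and the separation distance is $q_\chi=\frac12\min_{\chi_i\ne\chi_j}\|\chi_i-\chi_j\|_2$. At each step $\chi_{new}$ is a maximizer over $D$ (the construction presupposes that maximizers exist, e.g. $D$ closed; any maximizer may be chosen). *)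

(* Defs.v *)
From mathcomp Require Import all_boot all_order all_algebra finmap.
From mathcomp Require Import all_classical all_reals all_analysis.

Set Implicit Arguments.
Unset Strict Implicit.
Unset Printing Implicit Defensive.

Import Order.TTheory GRing.Theory Num.Theory.
Import numFieldNormedType.Exports.

Local Open Scope classical_set_scope.
Local Open Scope ring_scope.

(* The library's norm [`|x|] on ['rV[R]_n] is the sup norm; it induces the same
   topology and the same bounded sets as the Euclidean norm below. *)
Definition norm2 (R : realType) (n : nat) (x : 'rV[R]_n) : R :=
  Num.sqrt (\sum_(i < n) x ord0 i ^+ 2).

(* A nonempty connected open set, together with any part of its boundary: this
   covers open domains as well as closed ones, on which maximizers exist. *)
Definition is_domain (R : realType) (n : nat) (D : set 'rV[R]_n) : Prop :=
  exists U : set 'rV[R]_n,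
    [/\ open U, connected U, U !=set0, U `<=` D & D `<=` closure U].

(* [inf] of a nonempty finite set of reals is its minimum. *)
Definition min_dist (R : realType) (n : nat) (chi : {fset 'rV[R]_n})
    (x : 'rV[R]_n) : R :=
  inf [set norm2 (x - c) | c in [set` chi]].

Definition fill_distance (R : realType) (n : nat) (D : set 'rV[R]_n)
    (chi : {fset 'rV[R]_n}) : R :=
  sup [set min_dist chi x | x in D].

(* Meaningful when [chi] has at least two points; otherwise it is
   [2^-1 * inf set0 = 0]. *)
Definition separation_distance (R : realType) (n : nat)
    (chi : {fset 'rV[R]_n}) : R :=
  2^-1 * inf [set norm2 (p.1 - p.2) | p in
                [set p : 'rV[R]_n * 'rV[R]_n |
                  [/\ p.1 \in chi, p.2 \in chi & p.1 != p.2]]].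

Definition is_maximizer (R : realType) (T : Type) (D : set T) (f : T -> R)
    (z : T) : Prop :=
  D z /\ (forall x, D x -> f x <= f z).

Definition greedy_sequence (R : realType) (n : nat) (D : set 'rV[R]_n)
    (chi : nat -> {fset 'rV[R]_n}) : Prop :=
  (exists2 x1, D x1 & chi 0%N = [fset x1]%fset) /\
  (forall k, exists2 xnew,
     is_maximizer D (min_dist (chi k)) xnew & chi k.+1 = (xnew |` chi k)%fset).

Definition quasi_uniform (R : realType) (n : nat) (D : set 'rV[R]_n)
    (c : R) (chi : {fset 'rV[R]_n}) : Prop :=
  c^-1 * separation_distance chi <= fill_distance D chi
    <= c * separation_distance chi.

(* Main.v *)
(* Write h for the fill distance and q for the separation distance. A new point
   has distance h from the current set and h never increases, so distinct points
   of [chi] are always at distance at least h, that is h <= 2 q. Conversely, if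
   h < q then the closed balls of radius r around the points of [chi], with
   h < r < q, are pairwise disjoint and cover the connected set [D], which is
   impossible as soon as [chi] has two points; hence q <= h, and N = 1 works. *)
Require Import Defs.
From mathcomp Require Import all_boot all_order all_algebra finmap.
From mathcomp Require Import all_classical all_reals all_analysis.
From mathcomp Require Import ring lra.

Set Implicit Arguments.
Unset Strict Implicit.
Unset Printing Implicit Defensive.

Import Order.TTheory GRing.Theory Num.Theory.
Import numFieldNormedType.Exports.

Local Open Scope classical_set_scope.
Local Open Scope ring_scope.

(** * The Euclidean norm *)

Lemma norm2_ge0 (R : realType) (n : nat) (x : 'rV[R]_n) : 0 <= norm2 x.
Proof. exact: sqrtr_ge0. Qed.

Lemma norm2_sqr (R : realType) (n : nat) (x : 'rV[R]_n) :
  norm2 x ^+ 2 = \sum_(i < n) x ord0 i ^+ 2.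
Proof. by rewrite sqr_sqrtr// sumr_ge0// => i _; exact: sqr_ge0. Qed.

Lemma norm2N (R : realType) (n : nat) (x : 'rV[R]_n) : norm2 (- x) = norm2 x.
Proof. by congr Num.sqrt; apply: eq_bigr => i _; rewrite mxE sqrrN. Qed.

Lemma norm2_distC (R : realType) (n : nat) (x y : 'rV[R]_n) :
  norm2 (x - y) = norm2 (y - x).
Proof. by rewrite -norm2N opprB. Qed.

Lemma norm2_eq0 (R : realType) (n : nat) (x : 'rV[R]_n) :
  norm2 x = 0 -> x = 0.
Proof.
move=> x0; have := norm2_sqr x; rewrite x0 expr0n/= => /esym/eqP.
rewrite psumr_eq0 => [/allP xi0|i _]; last exact: sqr_ge0.
apply/rowP => i; rewrite mxE; apply/eqP; rewrite -sqrf_eq0.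
by apply: xi0; rewrite mem_index_enum.
Qed.

(** For nonzero vectors, the squared norm of [norm2 y * x - norm2 x * y] is nonnegative and factors
    as [2 * norm2 x * norm2 y] times the difference of the two sides. Zero vectors are split off so
    that this factor can be cancelled. *)
Lemma norm2_cauchy_schwarz (R : realType) (n : nat) (x y : 'rV[R]_n) :
  \sum_(i < n) x ord0 i * y ord0 i <= norm2 x * norm2 y.
Proof.
have [/norm2_eq0 ->|x0] := eqVneq (norm2 x) 0.
  rewrite big1 ?mulr_ge0 ?norm2_ge0// => i _.
  by rewrite mxE mul0r.
have [/norm2_eq0 ->|y0] := eqVneq (norm2 y) 0.
  rewrite big1 ?mulr_ge0 ?norm2_ge0// => i _.
  by rewrite mxE mulr0.
have xy0 : 0 < norm2 x * norm2 y by rewrite mulr_gt0// lt0r ?x0 ?y0 norm2_ge0.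
have : 0 <= \sum_(i < n) (norm2 y * x ord0 i - norm2 x * y ord0 i) ^+ 2.
  by apply: sumr_ge0 => i _; exact: sqr_ge0.
have -> : \sum_(i < n) (norm2 y * x ord0 i - norm2 x * y ord0 i) ^+ 2 =
    norm2 x * norm2 y *
    (2 * (norm2 x * norm2 y - \sum_(i < n) x ord0 i * y ord0 i)).
  under eq_bigr => i _.
    have -> : (norm2 y * x ord0 i - norm2 x * y ord0 i) ^+ 2 =
        norm2 y ^+ 2 * x ord0 i ^+ 2 + norm2 x ^+ 2 * y ord0 i ^+ 2
        - 2 * norm2 x * norm2 y * (x ord0 i * y ord0 i) by ring.
    over.
  by rewrite sumrB big_split/= -!mulr_sumr -!norm2_sqr; ring.
by rewrite pmulr_rge0// pmulr_rge0// subr_ge0.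
Qed.

Lemma norm2_triangle (R : realType) (n : nat) (x y : 'rV[R]_n) :
  norm2 (x + y) <= norm2 x + norm2 y.
Proof.
rewrite -(@ler_pXn2r _ 2)// ?nnegrE ?addr_ge0 ?norm2_ge0//.
rewrite norm2_sqr sqrrD.
under eq_bigr do rewrite mxE sqrrD.
rewrite !big_split/= -mulr2n -!norm2_sqr lerD2r lerD2l lerMn2r/=.
exact: norm2_cauchy_schwarz.
Qed.

Lemma norm2_continuous (R : realType) (n : nat) :
  continuous (@norm2 R n).
Proof.
move=> x; apply: (@continuous_comp _ _ _ _ (@Num.sqrt R)); last first.
  exact: sqrt_continuous.
move: x; apply: continuous_big => [|i _ x]; first exact: add_continuous.
apply: (@continuous_comp _ _ _ (fun y : 'rV[R]_n => y ord0 i)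
  (fun t : R => t ^+ 2)).
  exact: coord_continuous.
exact: exprn_continuous.
Qed.

(** * Connectedness of the domain *)

Lemma connected_between (T : topologicalType) (A B : set T) :
  connected A -> A `<=` B -> B `<=` closure A -> connected B.
Proof.
move=> Aconn AB BA V [z Vz] [C1 oC1 VC1] [C2 cC2 VC2].
(* Being relatively closed in [B], [V] contains the points of [B] in the closure of [A] as soon as
   it contains [A]; these are all of [B]. *)
suff AV : A `<=` V.
  rewrite VC2; apply/seteqP; split=> [x []//|x Bx]; split=> //.
  rewrite (closure_id C2).1//; apply: closureS (BA _ Bx).
  by apply: subset_trans AV _; rewrite VC2 => y [].
have AC (C : set T) : V = B `&` C -> A `&` V = A `&` C.
  by move=> ->; rewrite setIA (setIidl AB).
(* The trace of [V] on [A] is relatively clopen, and nonempty because the relatively open [V]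
   contains a point adherent to [A]. *)
rewrite -setIidPl; apply: Aconn.
- move: Vz; rewrite VC1 => -[Bz C1z].
  have [w [Aw C1w]] := BA _ Bz _ (open_nbhs_nbhs (conj oC1 C1z)).
  by exists w; split=> //; split=> //; exact: AB.
- by exists C1 => //; exact: AC.
- by exists C2 => //; exact: AC.
Qed.

Lemma domain_connected (R : realType) (n : nat) (D : set 'rV[R]_n) :
  is_domain D -> connected D.
Proof. by move=> [U [_ ? _ ? ?]]; exact: (@connected_between _ U). Qed.

(** The convention [inf set0 = 0] settles the empty case, which occurs for the separation distance
    of a single point. *)
Lemma inf_ge0 (R : realType) (A : set R) : lbound A 0 -> 0 <= inf A.
Proof.
have [->|/set0P A0] := eqVneq A set0; first by rewrite inf0.
exact: lb_le_inf.
Qed.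

(** * Distance to a finite set, fill distance and separation distance *)

Section min_dist.
Variables (R : realType) (n : nat).
Implicit Types (D : set 'rV[R]_n) (chi : {fset 'rV[R]_n}).

Lemma min_dist_le chi c x : c \in chi -> min_dist chi x <= norm2 (x - c).
Proof.
move=> cchi; apply: ge_inf; last by exists c.
by exists 0 => _ [y _ <-]; exact: norm2_ge0.
Qed.

Lemma min_dist_lt chi x r : chi != fset0 -> min_dist chi x < r ->
  exists2 c, c \in chi & norm2 (x - c) < r.
Proof.
move=> /fset0Pn[c0 c0chi] /inf_lt[|_ [c cchi <-] ?]; last by exists c.
by exists (norm2 (x - c0)), c0.
Qed.

Lemma min_dist_ge0 chi x : 0 <= min_dist chi x.
Proof.
by apply: inf_ge0 => _ [c _ <-]; exact: norm2_ge0.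
Qed.

Lemma le_min_dist chi chi' x : chi != fset0 -> (chi `<=` chi')%fset ->
  min_dist chi' x <= min_dist chi x.
Proof.
move=> /fset0Pn[c0 c0chi] /fsubsetP sub; apply: lb_le_inf.
  by exists (norm2 (x - c0)), c0.
by move=> _ [c cchi <-]; apply: min_dist_le; exact: sub.
Qed.

(** The maximizer provides both the upper bound and the element that make [sup] a genuine
    supremum. *)
Lemma fill_distance_maximizer D chi z : is_maximizer D (min_dist chi) z ->
  fill_distance D chi = min_dist chi z.
Proof.
move=> [Dz zmax]; have ub : ubound [set min_dist chi x | x in D] (min_dist chi z).
  by move=> _ [x Dx <-]; exact: zmax.
apply/eqP; rewrite eq_le; apply/andP; split.
  by apply: ge_sup => //; exists (min_dist chi z), z.
by apply: ub_le_sup; [exists (min_dist chi z)|exists z].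
Qed.

Lemma separation_distance_ge0 chi : 0 <= separation_distance chi.
Proof.
by apply: mulr_ge0 => //; apply: inf_ge0 => _ [p _ <-]; exact: norm2_ge0.
Qed.

Lemma separation_distance_le chi x y : x \in chi -> y \in chi -> x != y ->
  2 * separation_distance chi <= norm2 (x - y).
Proof.
move=> xchi ychi xy; rewrite mulrA divff ?mul1r//; apply: ge_inf.
  by exists 0 => _ [p _ <-]; exact: norm2_ge0.
by exists (x, y).
Qed.

Lemma cardfs_gt1 chi : (1 < #|` chi|)%N ->
  exists x y, [/\ x \in chi, y \in chi & x != y].
Proof.
move=> chi2; have /fset0Pn[x xchi] : chi != fset0.
  by rewrite -cardfs_gt0; exact: ltnW.
have [|nsub] := boolP (chi `<=` [fset x])%fset.
  by move=> /fsubset_leq_card; rewrite cardfs1 leqNgt chi2.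
have /fsubsetPn[y ychi] := nsub; rewrite inE => yx.
by exists y, x.
Qed.

Lemma separation_distance_le_sup D chi h : connected D ->
  {subset chi <= D} -> (1 < #|` chi|)%N ->
  (forall x, D x -> min_dist chi x <= h) -> separation_distance chi <= h.
Proof.
move=> Dconn chiD /cardfs_gt1[c [d [cchi dchi cd]]] cover.
rewrite leNgt; apply/negP => hq.
set q := separation_distance chi in hq *.
have chi0 : chi != fset0 by apply/fset0Pn; exists c.
(* Any radius strictly between [h] and [q] would do: above [h] the balls cover [D], below [q] they
   stay apart. *)
pose r := (h + q) / 2.
have [hr rq] : h < r /\ r < q by rewrite /r; split; lra.
have Dc : D c by have /[!inE] := chiD _ cchi.
have Dd : D d by have /[!inE] := chiD _ dchi.
have distc : continuous (fun x : 'rV[R]_n => norm2 (x - c)).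
  move=> x; apply: (@continuous_comp _ _ _ (fun x : 'rV[R]_n => x - c) (@norm2 R n)).
    by apply: continuousB; [move=> ?|exact: cst_continuous].
  exact: norm2_continuous.
have q0 : 0 < q.
  by apply: le_lt_trans hq; exact: le_trans (min_dist_ge0 _ _) (cover _ Dc).
(* [D] meets the ball of radius [q] around [c] in a relatively clopen set. *)
have balls : D `&` [set x | norm2 (x - c) < q] =
             D `&` [set x | norm2 (x - c) <= r].
  apply/seteqP; split=> x [Dx] /= xc; split=> //=; last exact: le_lt_trans rq.
  (* Some center [e] is within [r] of [x]. If [e] differed from [c], the two centers would be closer
     than [q + r < 2 * q], against the separation. *)
  have [e echi xe] := min_dist_lt chi0 (le_lt_trans (cover _ Dx) hr).
  have [->|ec] := eqVneq c e; first exact: ltW.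
  have := separation_distance_le cchi echi ec.
  have := norm2_triangle (c - x) (x - e).
  rewrite addrA subrK (norm2_distC c x) -/q; lra.
have : D `&` [set x | norm2 (x - c) < q] = D.
  apply: Dconn.
  - exists c; split=> //=; rewrite subrr.
    suff -> : norm2 (0 : 'rV[R]_n) = 0 by [].
    by rewrite /norm2 big1 ?sqrtr0// => i _; rewrite mxE expr0n.
  - exists [set x | norm2 (x - c) < q] => //.
    exact: (iffLR (continuousP _) distc _ (@open_lt _ q)).
  - exists [set x | norm2 (x - c) <= r] => //.
    exact: (iffLR (continuous_closedP _) distc _ (@closed_le _ r)).
(* The second center [d] would lie within [q] of [c], although it is at least [2 * q] away and [q]
   is positive. *)
move=> ballD; move: Dd; rewrite -ballD => -[_ /=].
rewrite norm2_distC; have := separation_distance_le cchi dchi cd.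
rewrite -/q; lra.
Qed.

End min_dist.

(** * Fill distance and separation along the greedy sequence *)

Section greedy.
Context {R : realType} {n : nat} {D : set 'rV[R]_n}.
Context {chi : nat -> {fset 'rV[R]_n}}.
Hypothesis chi_greedy : greedy_sequence D chi.

Lemma greedy_neq0 k : chi k != fset0.
Proof.
case: chi_greedy => -[x _ chi0] step; apply/fset0Pn; case: k => [|k].
  by exists x; rewrite chi0 inE.
by have [z _ ->] := step k; exists z; rewrite !inE eqxx.
Qed.

Lemma greedy_subset k : {subset chi k <= D}.
Proof.
case: chi_greedy => -[x Dx chi0] step; elim: k => [|k IH] y.
  by rewrite chi0 !inE => /eqP ->.
by have [z [Dz _] ->] := step k; rewrite !inE => /predU1P[->//|/IH]; rewrite inE.
Qed.

Lemma greedy_fill_distance_ge k x : D x ->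
  min_dist (chi k) x <= fill_distance D (chi k).
Proof.
have [z zmax _] := chi_greedy.2 k; rewrite (fill_distance_maximizer zmax).
exact: zmax.2.
Qed.

(** The maximizer for the larger set is a point of [D], and its distance to the smaller set is at
    least as large. *)
Lemma greedy_fill_distance_decr k :
  fill_distance D (chi k.+1) <= fill_distance D (chi k).
Proof.
have [z zmax _] := chi_greedy.2 k.+1; rewrite (fill_distance_maximizer zmax).
apply: le_trans (greedy_fill_distance_ge k zmax.1).
apply: le_min_dist; first exact: greedy_neq0.
by have [y _ ->] := chi_greedy.2 k; exact: fsubsetU1.
Qed.

Lemma greedy_separated k x y : x \in chi k -> y \in chi k -> x != y ->
  fill_distance D (chi k) <= norm2 (x - y).
Proof.
elim: k x y => [|k IH] x y.
  have [[z _ ->] _] := chi_greedy.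
  by rewrite !inE => /eqP -> /eqP ->; rewrite eqxx.
(* The larger bound at stage [k] holds for every pair: old pairs by induction, pairs with the new
   point [z] because its distance to [chi k] is exactly that bound. *)
move=> xchi ychi xy; apply: le_trans (greedy_fill_distance_decr k) _.
have [z zmax chiS] := chi_greedy.2 k.
have new c : c \in chi k -> fill_distance D (chi k) <= norm2 (z - c).
  by rewrite (fill_distance_maximizer zmax); exact: min_dist_le.
move: xchi ychi xy; rewrite chiS !inE.
move=> /predU1P[->|xk] /predU1P[->|yk] xy; first by rewrite eqxx in xy.
- exact: new.
- by rewrite norm2_distC; exact: new.
- exact: IH.
Qed.

End greedy.

Theorem theorem7 (R : realType) (n : nat) (D : set 'rV[R]_n)
    (chi : nat -> {fset 'rV[R]_n})
    (D_bounded : bounded_set D) (D_domain : is_domain D)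
    (chi_greedy : greedy_sequence D chi) :
  exists N : nat, forall k : nat,
    (N < #|` chi k|)%N -> quasi_uniform D 4 (chi k).
Proof.
(* Two distinct points make the infimum in the separation distance range over a nonempty set. *)
exists 1%N => k chik.
have q0 := separation_distance_ge0 (chi k).
have qh : separation_distance (chi k) <= fill_distance D (chi k).
  apply: (separation_distance_le_sup (domain_connected D_domain)) => //.
    exact: greedy_subset.
  by move=> x; exact: greedy_fill_distance_ge.
have hq : fill_distance D (chi k) <= 2 * separation_distance (chi k).
  have [x [y [xk yk xy]]] := cardfs_gt1 chik.
  rewrite mulrA divff ?mul1r//; apply: lb_le_inf.
    by exists (norm2 (x - y)), (x, y).
  by move=> _ [p [p1 p2 p12] <-]; exact: greedy_separated.
(* With [q] nonnegative, [q / 4 <= q <= h <= 2 * q <= 4 * q]. *)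
by apply/andP; split; lra.
Qed.
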